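(* Let $G$ be a nontrivial finite group. The following conditions are equivalent: (i) $cr(G)=1$ (that is, $G$ is incompressible). (ii) $G$ is of one of the following types: (a) a cyclic group of prime power order; (b) a generalized quaternion group of order $2^n$ for some $n\geq 3$; (c) the Klein four-group $V_4$. Further, $cr(G)<1.2$ if and only if $cr(G)=1$.
   Context: For a finite group $G$, $\mu(G)$ denotes the least positive integer $n$ such that $G$ embeds in the symmetric group $S_n$. The compression ratio of $G$ is $cr(G)=\frac{|G|}{\mu(G)}$. $G$ is called incompressible if $cr(G)=1$. The generalized quaternion groups of order $2^n$, $n\ge 3$, include the quaternion group $Q_8$. *)

(* Defs.v *)
From HB Require Import structures.
From mathcomp Require Import all_boot all_order all_algebra.
From mathcomp Require Import all_fingroup all_solvable.

Set Implicit Arguments.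
Unset Strict Implicit.
Unset Printing Implicit Defensive.

Import GroupScope.

Section Embedding.

Variables (gT : finGroupType) (G : {group gT}).

Definition embeds_in_Sym (n : nat) : bool :=
  [exists H : {group {perm 'I_n}}, G \isog H].

Lemma embeds_in_SymP n :
  reflect (exists f : {morphism G >-> {perm 'I_n}}, 'injm f) (embeds_in_Sym n).
Proof.
apply: (iffP existsP) => [[H /isogP[f injf _]] | [f injf]]; first by exists f.
by exists (f @* G)%G; apply/isogP; exists f.
Qed.

Definition cayley_fun (x : gT) (i : 'I_#|[subg G]|) : 'I_#|[subg G]| :=
  enum_rank_in (group1 [subg G]) (enum_val i * subg G x).

Lemma cayley_fun_inj x : injective (cayley_fun x).
Proof.
move=> i j /(congr1 enum_val); rewrite !enum_rankK_in ?inE //.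
by move/mulIg/enum_val_inj.
Qed.

Definition cayley_perm x := perm (@cayley_fun_inj x).

Lemma cayley_permM : {in G &, {morph cayley_perm : x y / x * y}}.
Proof.
move=> x y Gx Gy; apply/permP=> i; rewrite permM !permE /cayley_fun.
by rewrite enum_rankK_in ?inE // (morphM (subg_morphism G)) ?mulgA.
Qed.

Canonical cayley_morphism := Morphism cayley_permM.

Lemma injm_cayley : 'injm cayley_morphism.
Proof.
apply/injmP=> x y Gx Gy /permP/(_ (enum_rank_in (group1 [subg G]) 1)).
rewrite !permE => /(congr1 enum_val); rewrite !enum_rankK_in ?inE // !mul1g.
exact: (injmP (injm_subg G)).
Qed.

Lemma ex_embeds_in_Sym : exists n, (0 < n)%N && embeds_in_Sym n.
Proof.
exists #|[subg G]|; rewrite cardG_gt0 /=.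
by apply/embeds_in_SymP; exists cayley_morphism; apply: injm_cayley.
Qed.

Definition mu : nat := ex_minn ex_embeds_in_Sym.

Definition cr : rat := (#|G|%:R / mu%:R)%R.

Definition incompressible : Prop := cr = 1%R.

End Embedding.

Definition cyclic_prime_power (gT : finGroupType) (G : {group gT}) : Prop :=
  cyclic G /\ exists p k : nat, [/\ prime p, (0 < k)%N & #|G| = (p ^ k)%N].

Definition generalized_quaternion (gT : finGroupType) (G : {group gT}) : Prop :=
  exists2 n : nat, (3 <= n)%N & G \isog 'Q_(2 ^ n).

(* 'Z_2 is here the additive group of the integers modulo 2. *)
Definition klein_four (gT : finGroupType) (G : {group gT}) : Prop :=
  G \isog [set: 'Z_2 * 'Z_2].

(* Main.v *)
Require Import Defs.
From HB Require Import structures.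
From mathcomp Require Import all_boot all_order all_algebra.
From mathcomp Require Import all_fingroup all_solvable.
From mathcomp Require Import zify.

Set Implicit Arguments.
Unset Strict Implicit.
Unset Printing Implicit Defensive.

Import GroupScope.

(** Both equivalences follow from two facts: the groups of the list have
    [mu G = #|G|], and a nontrivial [G] with [cr G < 6/5] is in the list.

    For the first fact, let [G] be a cyclic [p]-group or a generalized
    quaternion group. It has a unique subgroup [Z] of prime order, so [Z] lies
    in every nontrivial subgroup. If [G] acts faithfully on a set, [Z] cannot
    lie in all the point stabilizers; hence some stabilizer is trivial, and its
    point has an orbit of [#|G|] elements ([monolith_embeds_in_Sym]). For the
    four-group it is enough that 4 does not divide [n!] when [n < 4].

    For the second fact, two subgroups [H] and [K] that meet trivially make the
    action of [G] on the cosets of [H] together with those of [K] faithful. So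
    [mu G / #|G| <= 1 / #|H| + 1 / #|K|], and the right-hand side is at most
    [5/6] as soon as [H] and [K] are nontrivial and not both of order 2, with
    equality for the orders 2 and 3 ([cr_ge_TI]). This is the source of the gap
    between 1 and 1.2. A group outside the list has such a pair:
    - if two primes divide [#|G|], Cauchy's theorem gives [H] and [K];
    - if [G] is a [p]-group whose elements of order [p] generate a subgroup
      ['Ohm_1(G)] of order [p], then [G] is cyclic or generalized quaternion, by
      the classification of [p]-groups with a unique subgroup of order [p];
    - in any other [p]-group, no cyclic subgroup contains all the elements of
      order [p]. So an element [z] of order at least 3 gives the pair [<[z]>],
      [<[t]>] for some [t] of order [p] outside [<[z]>]
      ([cr_lt_exponent2]);
    - if there is no such [z], [G] is an elementary abelian 2-group, and a
      subgroup of order 2 with a complement is such a pair, unless the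
      complement has order at most 2 ([cr_lt_exponent2_klein_four]). *)

(** * Permutation representations from actions *)

(** The type ['I_#|S|] serves as a copy of the invariant set [S], so a faithful
    action on [S] becomes an embedding into the symmetric group of degree
    [#|S|]; the point [x0] only provides a default for the numbering of [S]. *)
Lemma embeds_in_Sym_faithful (aT : finGroupType) (rT : finType)
    (to : {action aT &-> rT}) (G : {group aT}) (S : {set rT}) (x0 : rT) :
    x0 \in S -> [acts G, on S | to] -> [faithful G, on S | to] ->
  embeds_in_Sym G #|S|.
Proof.
(* The restricted action [<[nSG]>] is the identity off [G], so that [f a] below
   is a permutation for every [a], not just for those in [G]. *)
move=> Sx0 nSG /faithfulP ffG; pose act := <[nSG]>%act.
have Sact a i : act (@enum_val _ (mem S) i) a \in S.
  rewrite /= /actby; case: ifP => [/andP[Si Ga]|_]; last exact: enum_valP.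
  by rewrite (acts_act nSG).
pose f a (i : 'I_#|S|) : 'I_#|S| := enum_rank_in Sx0 (act (enum_val i) a).
have fK a i : enum_val (f a i) = act (enum_val i) a by rewrite enum_rankK_in.
have f_inj a : injective (f a).
  by move=> i j /(congr1 enum_val); rewrite !fK => /act_inj/enum_val_inj.
have fM : {in G &, {morph (fun a => perm (@f_inj a)) : a b / a * b}}.
  move=> a b Ga Gb; apply/permP=> i; apply: enum_val_inj.
  by rewrite permM !permE !fK actMin.
apply/embeds_in_SymP; exists (Morphism fM); apply/subsetP=> a.
case/morphpreP=> Ga /set1P fa1; apply/set1P/ffG => // x Sx.
have := congr1 (fun s : {perm _} => s (enum_rank_in Sx0 x)) fa1.
by move/(congr1 enum_val); rewrite perm1 permE fK enum_rankK_in // actbyE.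
Qed.

(** Not every point stabilizer contains [Z], as [Z] would act trivially; a
    stabilizer without [Z] is trivial, and its point has a regular orbit. *)
Lemma monolith_embeds_in_Sym (gT : finGroupType) (G Z : {group gT}) n :
    Z \subset G -> Z :!=: 1 ->
    (forall H : {group gT}, H \subset G -> H :!=: 1 -> Z \subset H) ->
  embeds_in_Sym G n -> #|G| <= n.
Proof.
move=> sZG ntZ minZ /embeds_in_SymP[f injf].
have [i /eqP H1 | allH] := pickP (fun i => f @*^-1 'C[i | 'P] == 1).
  have tiC : 'C_(f @* G)[i | 'P] = 1.
    by rewrite -morphim_setIpre H1 setIg1 morphim1.
  rewrite -(card_injm injf (subxx G)) -(indexg1 (f @* G)) -[1%G : {set _}]tiC.
  by rewrite -card_orbit -[n in _ <= n]card_ord max_card.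
case/negP: ntZ; rewrite -subG1 -(trivgP injf) //; apply/subsetP=> z Zz.
have Gz := subsetP sZG z Zz.
apply/morphpreP; split=> //; apply/set1P/permP=> i; rewrite perm1.
have : z \in f @*^-1 'C[i | 'P].
  apply: subsetP Zz; apply: (minZ (f @*^-1 'C[i | 'P])%G).
    exact: subsetIl.
  by rewrite /= allH.
by case/morphpreP=> _ /astab1P.
Qed.

(** * Bounds on the minimal degree and the compression ratio *)

Section MinimalDegree.

Variables (gT : finGroupType) (G : {group gT}).

Lemma mu_gt0 : 0 < mu G.
Proof. by rewrite /mu; case: ex_minnP => m /andP[]. Qed.

Lemma embeds_in_Sym_mu : embeds_in_Sym G (mu G).
Proof. by rewrite /mu; case: ex_minnP => m /andP[]. Qed.

Lemma mu_min n : 0 < n -> embeds_in_Sym G n -> mu G <= n.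
Proof.
by move=> n_gt0 embGn; rewrite /mu; case: ex_minnP => m _; apply; apply/andP.
Qed.

Lemma mu_le_order : mu G <= #|G|.
Proof.
rewrite (card_isog (isog_subg G)) mu_min //.
by apply/embeds_in_SymP; exists (cayley_morphism G); apply: injm_cayley.
Qed.

Lemma cr_eq1 : cr G = 1%R <-> mu G = #|G|.
Proof.
have mu_neq0 : ((mu G)%:R != 0 :> rat)%R.
  by rewrite Num.Theory.pnatr_eq0 -lt0n mu_gt0.
rewrite /cr; split=> [eq1 | ->]; last first.
  by rewrite GRing.divff // Num.Theory.pnatr_eq0 -lt0n.
apply/esym/eqP; rewrite -(Num.Theory.eqr_nat rat).
by rewrite -[X in X == _](GRing.divfK mu_neq0) eq1 GRing.mul1r.
Qed.

Lemma cr_lt_6_5 : (cr G < 6%:R / 5%:R)%R = (5 * #|G| < 6 * mu G).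
Proof.
rewrite /cr Num.Theory.ltr_pdivrMr ?Num.Theory.ltr0n ?mu_gt0 //.
rewrite GRing.mulrAC Num.Theory.ltr_pdivlMr ?Num.Theory.ltr0n //.
by rewrite -!GRing.natrM Num.Theory.ltr_nat mulnC.
Qed.

(** [G] acts by right translation on the cosets of [H] together with those of
    [K]. An element that fixes the cosets [H] and [K] lies in [H :&: K]. *)
Lemma mu_le_indices (H K : {group gT}) :
  H \subset G -> K \subset G -> H :&: K = 1 -> mu G <= #|G : H| + #|G : K|.
Proof.
move=> sHG sKG tiHK; pose S := rcosets H G :|: rcosets K G.
have SH : (H : {set gT}) \in S.
  by rewrite inE -{1}[H : {set gT}]mulg1 -rcosetE imset_f.
have SK : (K : {set gT}) \in S.
  by rewrite inE orbC -{1}[K : {set gT}]mulg1 -rcosetE imset_f.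
apply: (@leq_trans #|S|); last by rewrite cardsU leq_subr.
apply: mu_min; first by rewrite (cardD1 (H : {set gT})) SH.
apply: (embeds_in_Sym_faithful (to := 'Rs%act) SH).
  by rewrite actsU ?actsRs_rcosets.
apply/faithfulP=> a Ga fixa; apply/set1gP; rewrite -tiHK inE.
by rewrite -{1}(astab1Rs H) -(astab1Rs K); apply/andP; split; apply/astab1P/fixa.
Qed.

(** Given that [H] and [K] are nontrivial, [4 < #|H| * #|K|] says that they do
    not both have order 2; this is what makes [1 / #|H| + 1 / #|K| <= 5 / 6]. *)
Lemma cr_ge_TI (H K : {group gT}) :
    H \subset G -> K \subset G -> H :&: K = 1 ->
    H :!=: 1 -> K :!=: 1 -> 4 < #|H| * #|K| ->
  ~~ (cr G < 6%:R / 5%:R)%R.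
Proof.
move=> sHG sKG tiHK; rewrite -!cardG_gt1 cr_lt_6_5 -leqNgt => H_gt1 K_gt1 HK_gt4.
have := mu_le_indices sHG sKG tiHK; have := Lagrange sHG; have := Lagrange sKG.
move: #|H| #|K| #|G| #|G : H| #|G : K| (mu G) H_gt1 K_gt1 HK_gt4.
move=> a b g u v m a_gt1 b_gt1 ab_gt4 Eb Ea lemuv.
have ineq : 6 * (a + b) <= 5 * (a * b).
  by have [a_gt2 | a_le2] := ltnP 2 a; nia.
rewrite -(@leq_pmul2l (a * b)); nia.
Qed.

(** * The groups of the list are incompressible *)

(** For [G] as in the hypothesis, ['Ohm_1(G)] lies in every nontrivial subgroup
    [H]: it has prime order and meets [H] in at least ['Ohm_1(H)]. *)
Lemma mu_prime_Ohm1 : prime #|'Ohm_1(G)| -> mu G = #|G|.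
Proof.
move=> prZ; apply/eqP; rewrite eqn_leq mu_le_order /=.
apply: (@monolith_embeds_in_Sym _ G 'Ohm_1(G) _ (Ohm_sub 1 G)).
- by rewrite -cardG_gt1 prime_gt1.
- move=> H sHG; apply: contraR => not_sZH; rewrite -Ohm1_eq1 -subG1.
  by rewrite -(prime_TIg prZ not_sZH) subsetI OhmS ?Ohm_sub.
exact: embeds_in_Sym_mu.
Qed.

Lemma mu_klein_four : klein_four G -> mu G = #|G|.
Proof.
move=> isoG.
have oG : #|G| = 4 by rewrite (card_isog isoG) cardsT card_prod !card_ord.
apply/eqP; rewrite eqn_leq mu_le_order /= oG.
have /embeds_in_SymP[f injf] := embeds_in_Sym_mu.
have := cardSg (subsetT (f @* G)); rewrite card_injm // oG cardsT card_Sn.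
by case: (mu G) => [|[|[|[|]]]].
Qed.

Lemma cyclic_or_quaternion_prime_Ohm1 :
    G :!=: 1 -> cyclic_prime_power G \/ generalized_quaternion G ->
  prime #|'Ohm_1(G)|.
Proof.
move=> ntG [[cycG [p [k [p_pr _ oG]]]] | [n n_gt2 isoG]].
  by rewrite (Ohm1_cyclic_pgroup_prime (p := p)) // /pgroup oG pnatX pnat_id.
have pG : 2.-group G by rewrite /pgroup (card_isog isoG) card_quaternion // pnatX.
suff /(prime_Ohm1P pG ntG)->:
    cyclic G || (2 == 2) && (extremal_class G == Quaternion) by [].
by apply/orP; right; apply/eqP/quaternion_classP; exists n.
Qed.

Lemma mu_of_type :
    G :!=: 1 ->
    [\/ cyclic_prime_power G, generalized_quaternion G | klein_four G] ->
  mu G = #|G|.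
Proof.
move=> ntG [cycG | quatG | /mu_klein_four //].
  by apply/mu_prime_Ohm1/cyclic_or_quaternion_prime_Ohm1 => //; left.
by apply/mu_prime_Ohm1/cyclic_or_quaternion_prime_Ohm1 => //; right.
Qed.

(** * Groups of compression ratio below 6/5 *)

Lemma prime_Ohm1_cyclic_or_quaternion (p : nat) :
    p.-group G -> G :!=: 1 -> #|'Ohm_1(G)| = p ->
  cyclic_prime_power G \/ generalized_quaternion G.
Proof.
move=> pG ntG oZ; have [p_pr _ [k oG]] := pgroup_pdiv pG ntG.
have /(prime_Ohm1P pG ntG)/orP[cycG | /andP[_ /eqP/quaternion_classP]] := oZ.
  by left; split=> //; exists p, k.+1.
by right.
Qed.

(** Subgroups whose orders are distinct primes meet trivially and do not both
    have order 2. *)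
Lemma cr_lt_pgroup :
  G :!=: 1 -> (cr G < 6%:R / 5%:R)%R -> (pdiv #|G|).-group G.
Proof.
rewrite -cardG_gt1 => G_gt1 cr_lt; set p := pdiv #|G|.
have p_pr : prime p := pdiv_prime G_gt1.
apply/pgroupP=> q q_pr qG; apply: contraLR cr_lt; rewrite !inE => neq_qp.
have [x Gx ox] := Cauchy p_pr (pdiv_dvd _); have [y Gy oy] := Cauchy q_pr qG.
apply: (@cr_ge_TI <[x]> <[y]>); rewrite ?cycle_subG //.
- by rewrite coprime_TIg // -!orderE ox oy prime_coprime // dvdn_prime2 // eq_sym.
- by rewrite -cardG_gt1 -orderE ox prime_gt1.
- by rewrite -cardG_gt1 -orderE oy prime_gt1.
rewrite -!orderE ox oy; have p_gt1 := prime_gt1 p_pr; have q_gt1 := prime_gt1 q_pr.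
by have [p_gt2 | p_le2] := ltnP 2 p; nia.
Qed.

(** If all the elements of prime order were in [<[z]>], then ['Ohm_1(G)], which
    they generate, would be cyclic and equal to its own ['Ohm_1], which has
    order [p]. *)
Lemma exists_prime_order_notin_cycle (p : nat) z :
    p.-group G -> G :!=: 1 -> #|'Ohm_1(G)| != p -> z \in G ->
  exists2 t, t \in G & prime #[t] && (t \notin <[z]>).
Proof.
move=> pG ntG noZ Gz; apply/exists_inP; apply: contraR noZ => /exists_inPn allz.
have cycZ : cyclic 'Ohm_1(G).
  apply: (@cyclicS _ <[z]> _ _ (cycle_cyclic z)); rewrite /= Ohm1Eprime gen_subG.
  by apply/subsetP=> t /setIdP[/allz]; rewrite negb_and negbK => /orP[/negP|].
have pZ := pgroupS (Ohm_sub 1 G) pG.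
by rewrite -Ohm_id (Ohm1_cyclic_pgroup_prime cycZ pZ) ?Ohm1_eq1.
Qed.

Lemma cr_lt_exponent2 (p : nat) :
    p.-group G -> G :!=: 1 -> #|'Ohm_1(G)| != p ->
  (cr G < 6%:R / 5%:R)%R -> exponent G %| 2.
Proof.
move=> pG ntG noZ cr_lt; apply/exponentP=> z Gz; apply/eqP.
rewrite -order_dvdn; apply: contraLR cr_lt => z2.
have [t Gt /andP[t_pr notzt]] := exists_prime_order_notin_cycle pG ntG noZ Gz.
have z_gt2 : 2 < #[z] by case: #[z] (order_gt0 z) z2 => [|[|[|]]].
apply: (@cr_ge_TI <[t]> <[z]>); rewrite ?cycle_subG //.
- by rewrite prime_TIg // cycle_subG.
- by rewrite -cardG_gt1 prime_gt1.
- by rewrite -cardG_gt1 -orderE ltnW.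
by rewrite -!orderE; have := prime_gt1 t_pr; nia.
Qed.

(** The pair that witnesses a large ratio is a subgroup of order 2 and a
    complement, so the complement must have order at most 2; order 1 would make
    [G] of order 2, equal to its own ['Ohm_1]. *)
Lemma cr_lt_exponent2_klein_four :
    exponent G %| 2 -> G :!=: 1 -> #|'Ohm_1(G)| != pdiv #|G| ->
  (cr G < 6%:R / 5%:R)%R -> klein_four G.
Proof.
move=> /exponent2_abelem abelG ntG; rewrite (Ohm1_id abelG) => noZ cr_lt.
have [x Gx ntx] := trivgPn _ ntG; have ox := abelem_order_p abelG Gx ntx.
have G_neq2 : #|G| != 2 by apply: contra noZ => /eqP->.
have sxG : <[x]> \subset G by rewrite cycle_subG.
have [K /complP[tiK defG]] := splitsP (abelem_splits abelG sxG).
have sKG : K \subset G by rewrite -defG mulG_subr.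
have oG : #|G| = (2 * #|K|)%N by rewrite -defG TI_cardMg // -orderE ox.
have oK : #|K| = 2.
  apply/eqP; apply: contraLR cr_lt => K_neq2.
  have K_gt1 : 1 < #|K| by move: (cardG_gt0 K); lia.
  apply: (cr_ge_TI sxG sKG tiK); rewrite -?cardG_gt1 -?orderE ?ox //; lia.
rewrite /klein_four (isog_abelem_card _ abelG) oG oK cardsT card_prod !card_ord.
rewrite andbT; apply: exponent2_abelem.
(* The exponent of ['Z_2 * 'Z_2] is checked on its four elements. *)
by apply/exponentP=> -[[[|[]] //= ?] [[|[]] //= ?]] _; apply/eqP.
Qed.

Lemma cr_lt_type :
    G :!=: 1 -> (cr G < 6%:R / 5%:R)%R ->
  [\/ cyclic_prime_power G, generalized_quaternion G | klein_four G].
Proof.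
move=> ntG cr_lt; have pG := cr_lt_pgroup ntG cr_lt.
have [oZ | noZ] := eqVneq #|'Ohm_1(G)| (pdiv #|G|).
  have [] := prime_Ohm1_cyclic_or_quaternion pG ntG oZ; first by constructor 1.
  by constructor 2.
have expG := cr_lt_exponent2 pG ntG noZ cr_lt; constructor 3.
exact: cr_lt_exponent2_klein_four expG ntG noZ cr_lt.
Qed.

End MinimalDegree.

Theorem theorem16 (gT : finGroupType) (G : {group gT}) (ntG : G :!=: 1) :
  (incompressible G <->
     [\/ cyclic_prime_power G, generalized_quaternion G | klein_four G])
  /\ ((cr G < 6%:R / 5%:R)%R <-> cr G = 1%R).
Proof.
have cr1_lt : cr G = 1%R -> (cr G < 6%:R / 5%:R)%R by move->.
have type_cr1 :
    [\/ cyclic_prime_power G, generalized_quaternion G | klein_four G] ->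
  cr G = 1%R by move/(mu_of_type ntG)/cr_eq1.
split; split; first by move/cr1_lt/(cr_lt_type ntG).
- exact: type_cr1.
- by move/(cr_lt_type ntG)/type_cr1.
exact: cr1_lt.
Qed.
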